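(* Let $n=2^k+r$ with integers $k\ge 0$ and $0\le r<2^k$, and let $n=\sum_{i=0}^k n_i2^i$ with $n_i\in\{0,1\}$ be its binary expansion. Then $$\tau\left(\frac{r}{2^k}\right)=\frac{1}{2^k}\sum_{i=0}^{k-1}2^i\cdot n_i\cdot\Bigl(k-i-2\sum_{j=i}^k n_j+4\Bigr),$$ or alternatively $$\tau\left(\frac{r}{2^k}\right)=\frac{1}{2^k}\sum_{i=0}^{k-1}2^i\cdot n_i\cdot\Bigl(k-i-2\,s_1\Bigl(\left\lfloor \frac{n}{2^i}\right\rfloor\Bigr)+4\Bigr).$$
   Context: The Hamming weight $s_1(m)$ is the number of $1$s in the binary expansion of $m$. $\tau$ denotes the Takagi function on $[0,1]$, a continuous function. On dyadic rationals it is given as follows: for integers $k\ge 0$ and $0\le N<2^{k+1}$ with binary digits $N=\sum_{i=0}^{k}N_i2^i$, $N_i\in\{0,1\}$, and $N_i=0$ for every negative integer $i$, $\tau\left(\frac{N}{2^{k+1}}\right)=\sum_{i=1}^\infty \frac{\ell_i(N)}{2^i}$, where for $i\ge 0$, $\ell_{i+1}(N)=\sum_{j=0}^{i-1}N_{k-j}$ if $N_{k-i}=0$, and $\ell_{i+1}(N)=i-\sum_{j=0}^{i-1}N_{k-j}$ if $N_{k-i}=1$. (Equivalently, $\tau(x)=\sum_{m=0}^\infty 2^{-m}\,\mathrm{dist}(2^m x,\mathbb{Z})$ for $x\in[0,1]$.) Empty sums are $0$. *)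

(* Defs.v *)
From mathcomp Require Import all_boot all_order all_algebra.
From mathcomp Require Import all_classical all_reals all_analysis.
From mathcomp Require Import zify ring lra.
Set Implicit Arguments. Unset Strict Implicit. Unset Printing Implicit Defensive.
Import Order.TTheory GRing.Theory Num.Theory.
Import numFieldNormedType.Exports.
Local Open Scope classical_set_scope.
Local Open Scope ring_scope.

Definition bit (n i : nat) : bool := odd (n %/ 2 ^ i).

(* [trunc_log 2 m] is the position of the leading binary digit of m > 0;
   [trunc_log 2 0 = 0], so that [hamming_weight 0 = 0]. *)
Definition hamming_weight (m : nat) : nat :=
  (\sum_(i < (trunc_log 2 m).+1) bit m i)%N.

Definition dist_int (R : realType) (x : R) : R :=
  inf [set `|x - z%:~R| | z in [set: int]].

Definition takagi_term (R : realType) (x : R) (m : nat) : R :=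
  dist_int (2 ^+ m * x) / 2 ^+ m.

(* The Takagi function, here as its 1-periodic extension to the whole line. *)
Definition takagi (R : realType) (x : R) : R := limn (series (takagi_term x)).

(* The rest of the file relates [takagi] to the other usual description of the
   Takagi function, by binary digits: [takagi_dyadic] at the end.
   Below, b is the sequence of binary digits of a number of [0, 1[ , most
   significant digit first and indexed from 0, and [ell b i] is the coefficient
   of 2^-(i+1) in the digit expansion of the Takagi function. *)
Definition ell (b : nat -> bool) (i : nat) : nat :=
  (if b i then i - \sum_(j < i) b j else \sum_(j < i) b j)%N.

(* Digits of N / 2^(k+1), where N < 2^(k+1). *)
Definition frac_bit (k N i : nat) : bool := (i <= k)%N && bit N (k - i).

Section dyadic.
Context {R : realType}.
Implicit Types (x : R) (b : nat -> bool).

Let dlb x : has_lbound [set `|x - z%:~R| | z in [set: int]].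
Proof. by exists 0 => _ [z _ <-]; exact: normr_ge0. Qed.

Lemma dist_int_lo x : 0 <= x <= 2^-1 -> dist_int x = x.
Proof.
move=> /andP[x0 x1]; apply/eqP; rewrite eq_le; apply/andP; split.
  by apply: ge_inf; [exact: dlb|exists 0 => //; rewrite subr0 ger0_norm].
apply: lb_le_inf; first by exists `|x - 0%:~R|, 0.
move=> _ [z _ <-]; have [z0|z0] := leP z 0.
  have : (z%:~R : R) <= 0 by rewrite lerz0.
  by move=> ?; rewrite ger0_norm; lra.
have : (1 : R) <= z%:~R by rewrite -[1]/(1%:~R) ler_int; lia.
by move=> ?; rewrite ler0_norm; lra.
Qed.

Lemma dist_int_hi x : 2^-1 <= x <= 1 -> dist_int x = 1 - x.
Proof.
move=> /andP[x0 x1]; apply/eqP; rewrite eq_le; apply/andP; split.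
  apply: ge_inf; [exact: dlb|exists 1 => //].
  by rewrite distrC ger0_norm // subr_ge0.
apply: lb_le_inf; first by exists `|x - 0%:~R|, 0.
move=> _ [z _ <-]; have [z0|z0] := leP z 0.
  have : (z%:~R : R) <= 0 by rewrite lerz0.
  by move=> ?; rewrite ger0_norm; lra.
have : (1 : R) <= z%:~R by rewrite -[1]/(1%:~R) ler_int; lia.
by move=> ?; rewrite ler0_norm; lra.
Qed.

Lemma dist_int_per x (n : nat) : dist_int (x + n%:R) = dist_int x.
Proof.
rewrite /dist_int; congr inf; apply/seteqP; split => _ [z _ <-].
  exists (z - n%:Z) => //; congr `|_|; rewrite intrB -pmulrn; ring.
exists (z + n%:Z) => //; congr `|_|; rewrite intrD -pmulrn; ring.
Qed.

Lemma takagi_term0 x : takagi_term x 0 = dist_int x.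
Proof. by rewrite /takagi_term expr0 mul1r divr1. Qed.

Lemma takagi_termS (e : bool) x m :
  takagi_term ((e%:R + x) / 2) m.+1 = takagi_term x m / 2.
Proof.
rewrite /takagi_term.
have -> : 2 ^+ m.+1 * ((e%:R + x) / 2) = 2 ^+ m * x + (2 ^ m * e)%N%:R.
  by rewrite natrM natrX exprS; field.
by rewrite dist_int_per exprS invfM [2^-1 * _]mulrC mulrA.
Qed.

Let sumb_le b i : (\sum_(j < i) b j <= i)%N.
Proof.
rewrite -[X in (_ <= X)%N]card_ord -sum1_card; apply: leq_sum => j _.
exact: leq_b1.
Qed.

Lemma ellS b i :
  ell b i.+1 = (ell (fun j => b j.+1) i + (b 0%N (+) b i.+1))%N.
Proof.
rewrite /ell big_ord_recl /=.
have := sumb_le (fun j => b j.+1) i.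
rewrite -/(bump 0 _) /bump /=; set S := (\sum_(j < i) b j.+1)%N.
by case: (b i.+1); case: (b 0%N) => /=; lia.
Qed.

Let cvgn_recl (u v : R^nat) (l : R) : (forall m, u m.+1 = v m) ->
  series v @ \oo --> l -> series u @ \oo --> u 0%N + l.
Proof.
move=> uv vl; rewrite -cvg_shiftS.
rewrite (_ : (fun _ => _) = (fun=> u 0%N) + series v); last first.
  apply/funext => n; rewrite /series /= big_nat_recl //; congr (_ + _).
  by apply: eq_bigr => i _; exact: uv.
by apply: cvgD vl; exact: cvg_cst.
Qed.

Let cvg_seriesZ (u : R^nat) (l c : R) :
  series u @ \oo --> l -> series (fun i => u i * c) @ \oo --> l * c.
Proof.
move=> ul; rewrite (_ : series _ = (fun n => series u n * c)).
  exact: cvgMl.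
by apply/funext => n; rewrite /series /= mulr_suml.
Qed.

Let cvg_seriesD (u v : R^nat) (l m : R) : series u @ \oo --> l ->
  series v @ \oo --> m -> series (fun i => u i + v i) @ \oo --> l + m.
Proof.
move=> ul vm; rewrite (_ : series _ = series u + series v); first exact: cvgD.
by apply/funext => n; rewrite /series /= big_split.
Qed.

Let cvg_series0 (u : R^nat) : (forall n, u n = 0) -> series u @ \oo --> (0 : R).
Proof.
move=> u0; rewrite (_ : series u = fun=> 0); first exact: cvg_cst.
by apply/funext => n; rewrite /series /= big1.
Qed.

Let cvg_half : series (fun i => 2^-1 ^+ i.+1 : R) @ \oo --> (1 : R).
Proof.
rewrite (_ : series _ = (fun=> 1) - (fun n => 2^-1 ^+ n)); last first.
  apply/funext; elim=> [|n IH]; first by rewrite /series /= big_geq // fctE subrr.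
  move: IH; rewrite /series /= !fctE big_nat_recr //= => ->.
  by rewrite exprS; field.
rewrite -[X in _ --> X]subr0; apply: cvgB; first exact: cvg_cst.
by apply: cvg_expr; rewrite ger0_norm; lra.
Qed.

Let val k b : R := \sum_(i < k) (b i)%:R * 2^-1 ^+ i.+1.

Let valS k b : val k.+1 b = ((b 0%N)%:R + val k (fun j => b j.+1)) / 2.
Proof.
rewrite /val big_ord_recl /= expr1 mulrDl; congr (_ + _).
by rewrite mulr_suml; apply: eq_bigr => i _; rewrite [in LHS]exprSr mulrA.
Qed.

Let val01 k b : 0 <= val k b <= 1.
Proof.
elim: k b => [|k IH] b; first by rewrite /val big_ord0 lexx ler01.
by rewrite valS; case: (b 0%N); move: (IH (fun j => b j.+1)) => /=; lra.
Qed.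

Let cvg_val k b : (forall i, (k <= i)%N -> b i = false) ->
  series (fun i => (b i)%:R * 2^-1 ^+ i.+1) @ \oo --> val k b.
Proof.
elim: k b => [|k IH] b bk.
  rewrite /val big_ord0; apply: cvg_series0 => n.
  by rewrite bk // mul0r.
rewrite valS mulrDl -[X in X + _]/((b 0%N)%:R * 2^-1 ^+ 1).
apply: (cvgn_recl (v := fun i => (b i.+1)%:R * 2^-1 ^+ i.+1 * 2^-1)).
  by move=> m; rewrite [in LHS]exprSr mulrA.
by apply/cvg_seriesZ/IH => i ki; exact: bk.
Qed.

Let takagi_ell k b : (forall i, (k <= i)%N -> b i = false) ->
  exists l : R, series (takagi_term (val k b)) @ \oo --> l /\
                series (fun i => (ell b i)%:R * 2^-1 ^+ i.+1) @ \oo --> l.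
Proof.
elim: k b => [|k IH] b bk.
  exists 0; split; apply: cvg_series0 => n.
    by rewrite /val big_ord0 /takagi_term mulr0 dist_int_lo ?mul0r; lra.
  by rewrite /ell bk // big1 ?mul0r // => i _; rewrite bk.
set b' := fun j => b j.+1.
have bk' i : (k <= i)%N -> b' i = false by move=> ki; exact: bk.
have [l [lT lE]] := IH b' bk'.
have := val01 k b'; set x := val k b' => x01.
exists (dist_int (val k.+1 b) + l / 2); split.
  rewrite -takagi_term0.
  apply: (cvgn_recl (v := fun m => takagi_term x m / 2)).
    by move=> m; rewrite valS; exact: takagi_termS.
  exact: cvg_seriesZ.
have -> : dist_int (val k.+1 b) + l / 2 =
    (ell b 0)%:R * 2^-1 ^+ 1 +
    (l / 2 + (if b 0%N then 1 + x * -1 else x) / 2).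
  rewrite valS -/b' -/x /ell big_ord0 subn0 if_same mul0r.
  case: (b 0%N) => /=; first by rewrite dist_int_hi; lra.
  by rewrite dist_int_lo; lra.
apply: (cvgn_recl (v := fun i => (ell b' i)%:R * 2^-1 ^+ i.+1 / 2
    + (b 0%N (+) b' i)%:R * 2^-1 ^+ i.+1 / 2)).
  by move=> m; rewrite ellS natrD [in LHS]exprSr mulrA !mulrDl.
apply: cvg_seriesD; apply: cvg_seriesZ => //.
case: (b 0%N) => /=; last exact: cvg_val.
rewrite (_ : (fun i => _) = (fun i =>
  2^-1 ^+ i.+1 + (b' i)%:R * 2^-1 ^+ i.+1 * -1)).
  by apply: cvg_seriesD => //; apply/cvg_seriesZ/cvg_val.
by apply/funext => i; case: (b' i) => /=; ring.
Qed.

Let bitE k N : (N < 2 ^ k)%N -> N = (\sum_(i < k) bit N i * 2 ^ i)%N.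
Proof.
elim: k N => [|k IH] N Nk; first by rewrite big_ord0; lia.
have Nk2 : (N %/ 2 < 2 ^ k)%N by rewrite ltn_divLR // -expnSr.
rewrite big_ord_recl /= {1}/bit expn0 divn1 muln1.
rewrite -[LHS]odd_double_half; congr (_ + _)%N.
rewrite -divn2 {1}(IH _ Nk2) -muln2 big_distrl; apply: eq_bigr => i _.
by rewrite /bit -divnMA -expnS /= /bump /= add1n expnSr mulnA.
Qed.

Let val_frac k N : (N < 2 ^ k.+1)%N ->
  val k.+1 (frac_bit k N) = N%:R / 2 ^+ k.+1.
Proof.
move=> Nk; rewrite {2}(bitE Nk) natr_sum mulr_suml /val.
rewrite (reindex_inj rev_ord_inj) /=.
apply: eq_bigr => i _; have ik := ltn_ord i.
rewrite /frac_bit subSS leq_subr subKn // natrM natrX -mulrA; congr (_ * _).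
have -> : 2 ^+ k.+1 = 2 ^+ (k - i).+1 * 2 ^+ i :> R.
  by rewrite -exprD; congr (_ ^+ _); lia.
by rewrite exprVn invfM mulrCA mulfV ?mulr1 // expf_neq0.
Qed.

Lemma takagi_dyadic (k N : nat) : (N < 2 ^ k.+1)%N ->
  series (fun i => (ell (frac_bit k N) i)%:R / 2 ^+ i.+1 : R) @ \oo -->
  takagi (N%:R / 2 ^+ k.+1 : R).
Proof.
move=> Nk; have [|l [lT lE]] := @takagi_ell k.+1 (frac_bit k N).
  by move=> i ki; rewrite /frac_bit leqNgt ki.
rewrite -(val_frac Nk) /takagi (cvg_lim _ lT) //.
by under eq_fun => i do rewrite -exprVn.
Qed.

End dyadic.

(* Main.v *)
Require Import Defs.
From mathcomp Require Import all_boot all_order all_algebra.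
From mathcomp Require Import all_classical all_reals all_analysis.
From mathcomp Require Import zify ring lra.
Set Implicit Arguments. Unset Strict Implicit. Unset Printing Implicit Defensive.
Import Order.TTheory GRing.Theory Num.Theory.
Import numFieldNormedType.Exports.
Local Open Scope ring_scope.

(** The Takagi function satisfies [takagi ((e + x) / 2) = d + takagi x / 2] for
    a digit [e] and [x] in [0, 1], where [d], the distance from [(e + x) / 2]
    to the integers, is [x / 2] or [(1 - x) / 2] according to [e]
    ([cvg_series_takagi_half], [dist_int_half]).  Prepending the digit [e] to
    the binary expansion of [x = r / 2 ^ k] is exactly such a step.

    The digit sum obeys the same recursion ([takagi_sumS]): when [k] grows by
    one, every old factor changes by [1 - 2 * e], and these changes, weighted by
    [2 ^ i * b i], add up to [(1 - 2 * e) * x / 2] after the new normalization;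
    the new top digit contributes [e / 2].  The total increment
    [(e + (1 - 2 * e) * x) / 2] is the distance [d] above.  Both sides vanish
    for [k = 0], so they agree ([cvg_series_takagi_dyadic]).

    The leading digit of [n] only adds [1] to each sum of digits, and the second
    formula follows since the digits of [n %/ 2 ^ i] are those of [n] from
    position [i] on. *)

Definition of_digits (b : nat -> bool) (k : nat) : nat :=
  (\sum_(i < k) b i * 2 ^ i)%N.

Lemma of_digitsSr b k : of_digits b k.+1 = (of_digits b k + b k * 2 ^ k)%N.
Proof. by rewrite /of_digits big_ord_recr. Qed.

Lemma of_digitsSl b k :
  of_digits b k.+1 = (b 0%N + (of_digits (fun j => b j.+1) k).*2)%N.
Proof.
rewrite /of_digits big_ord_recl /= expn0 muln1 -muln2 big_distrl /=.
by congr (_ + _)%N; apply: eq_bigr => i _; rewrite expnSr mulnA.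
Qed.

Lemma of_digits_lt b k : (of_digits b k < 2 ^ k)%N.
Proof.
elim: k => [|k IH]; first by rewrite /of_digits big_ord0.
by rewrite of_digitsSr expnS; case: (b k) => /=; lia.
Qed.

Lemma bit_of_digits b k j : (j < k)%N -> bit (of_digits b k) j = b j.
Proof.
elim: j b k => [|j IH] b [|k] // jk; rewrite of_digitsSl /bit.
  by rewrite expn0 divn1 oddD odd_double addbF oddb.
by rewrite expnS divnMA divn2 half_bit_double; exact: (IH (fun j => b j.+1)).
Qed.

Lemma hamming_weightE m k : (2 ^ k <= m < 2 ^ k.+1)%N ->
  hamming_weight m = (\sum_(0 <= j < k.+1) bit m j)%N.
Proof.
by move=> mk; rewrite /hamming_weight (trunc_log_eq _ mk) // big_mkord.
Qed.

(** As [b k] is set, the quotient has its leading digit exactly at position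
    [k - i], and its digits are those of [b] shifted by [i]. *)
Lemma hamming_weight_div (b : nat -> bool) k i : b k -> (i <= k)%N ->
  hamming_weight (of_digits b k.+1 %/ 2 ^ i) = (\sum_(i <= j < k.+1) b j)%N.
Proof.
move=> bk ik; rewrite (@hamming_weightE _ (k - i)); last first.
  rewrite leq_divRL ?expn_gt0// ltn_divLR ?expn_gt0// -!expnD addSn subnK //.
  by rewrite of_digits_lt andbT of_digitsSr bk mul1n leq_addl.
rewrite -[in RHS](add0n i) big_addn subSn //.
apply: eq_big_nat => j /andP[_ jk].
by rewrite /bit -divnMA -expnD addnC -/(bit _ _) bit_of_digits; lia.
Qed.

Section takagi_recursion.
Local Open Scope classical_set_scope.
Local Open Scope ring_scope.
Context {R : realType}.
Implicit Types (x l : R) (b : nat -> bool).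

Lemma dist_int_half (e : bool) x : 0 <= x <= 1 ->
  dist_int ((e%:R + x) / 2) = (e%:R + (1 - 2 * e%:R) * x) / 2.
Proof.
move=> x01; case: e => /=; first by rewrite dist_int_hi; lra.
by rewrite dist_int_lo; lra.
Qed.

(** All terms but the first of the series at [(e + x) / 2] are the halved terms
    of the series at [x].  Transporting the limit itself gives convergence along
    with the functional equation. *)
Lemma cvg_series_takagi_half (e : bool) x l :
  series (takagi_term x) @ \oo --> l ->
  series (takagi_term ((e%:R + x) / 2)) @ \oo -->
    dist_int ((e%:R + x) / 2) + l / 2.
Proof.
move=> xl; rewrite -cvg_shiftS.
rewrite (_ : (fun _ => _) =
    (fun n => dist_int ((e%:R + x) / 2) + series (takagi_term x) n / 2)).
  by apply: cvgD; [exact: cvg_cst | exact: cvgMr_tmp].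
apply/funext => n; rewrite /series /= big_nat_recl // takagi_term0 mulr_suml.
by congr (_ + _); apply: eq_bigr => i _; rewrite takagi_termS.
Qed.

Lemma cvg_series_takagi0 : series (takagi_term (0 : R)) @ \oo --> (0 : R).
Proof.
rewrite (_ : series _ = fun=> 0); first exact: cvg_cst.
apply/funext => n; rewrite /series /= big1 // => i _.
by rewrite /takagi_term mulr0 dist_int_lo ?mul0r; lra.
Qed.

Definition dyadic b k : R := (of_digits b k)%:R / 2 ^+ k.

Lemma dyadicS b k : dyadic b k.+1 = ((b k)%:R + dyadic b k) / 2.
Proof.
rewrite /dyadic of_digitsSr natrD natrM natrX exprS.
by field; rewrite expf_neq0.
Qed.

Lemma dyadic_itv01 b k : 0 <= dyadic b k <= 1.
Proof.
elim: k => [|k IH].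
  by rewrite /dyadic /of_digits big_ord0 mul0r lexx ler01.
by rewrite dyadicS; case: (b k) => /=; lra.
Qed.

(** Here [b] lists the digits of [r] only: the leading digit of
    [n = 2 ^ k + r] would add [1] to each sum of digits, which accounts for [2]
    in place of [4]. *)
Definition takagi_sum b k : R :=
  1 / 2 ^+ k * \sum_(0 <= i < k)
    2 ^+ i * (b i)%:R * (k%:R - i%:R - 2 * (\sum_(i <= j < k) (b j)%:R) + 2).

Lemma takagi_sumS b k :
  takagi_sum b k.+1 =
    ((b k)%:R + (1 - 2 * (b k)%:R) * dyadic b k) / 2 + takagi_sum b k / 2.
Proof.
rewrite /takagi_sum big_nat_recr //= big_nat1.
set S := (X in _ = _ + _ * X / 2).
(* Each old factor changes by [1 - 2 * b k]. *)
under eq_big_nat => i /andP[_ ik].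
  rewrite big_nat_recr ?(ltnW ik) //=.
  rewrite (_ : _ * _ = 2 ^+ i * (b i)%:R *
      (k%:R - i%:R - 2 * (\sum_(i <= j < k) (b j)%:R) + 2) +
    (b i * 2 ^ i)%N%:R * (1 - 2 * (b k)%:R)); last first.
    by rewrite natrM natrX -(natr1 k); ring.
  over.
rewrite big_split /= -/S -mulr_suml -natr_sum big_mkord -/(of_digits b k).
rewrite /dyadic exprS -(natr1 k).
(* A binary digit is its own square. *)
by case: (b k) => /=; field; rewrite expf_neq0.
Qed.

Lemma cvg_series_takagi_dyadic b k :
  series (takagi_term (dyadic b k)) @ \oo --> takagi_sum b k.
Proof.
elim: k => [|k IH].
  rewrite /dyadic /of_digits big_ord0 mul0r /takagi_sum big_geq // mulr0.
  exact: cvg_series_takagi0.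
rewrite takagi_sumS dyadicS -(dist_int_half _ (dyadic_itv01 b k)).
exact: cvg_series_takagi_half.
Qed.

End takagi_recursion.

Theorem theorem27 (R : realType) (n k r : nat) (b : nat -> bool)
    (hr : (r < 2 ^ k)%N) (hn : n = (2 ^ k + r)%N)
    (hb : n = (\sum_(i < k.+1) b i * 2 ^ i)%N) :
  takagi (r%:R / 2 ^+ k : R) =
    1 / 2 ^+ k * \sum_(0 <= i < k)
      2 ^+ i * (b i)%:R *
        (k%:R - i%:R - 2 * (\sum_(i <= j < k.+1) (b j)%:R) + 4)
  /\
  takagi (r%:R / 2 ^+ k : R) =
    1 / 2 ^+ k * \sum_(0 <= i < k)
      2 ^+ i * (b i)%:R *
        (k%:R - i%:R - 2 * (hamming_weight (n %/ 2 ^ i))%:R + 4).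
Proof.
rewrite -/(of_digits b k.+1) in hb.
have [bk rE] : b k /\ r = of_digits b k.
  move: hb; rewrite hn of_digitsSr; have := of_digits_lt b k.
  by case: (b k) => /=; lia.
have digit_sum_formula : takagi (r%:R / 2 ^+ k : R) =
    1 / 2 ^+ k * \sum_(0 <= i < k)
      2 ^+ i * (b i)%:R *
        (k%:R - i%:R - 2 * (\sum_(i <= j < k.+1) (b j)%:R) + 4).
  rewrite rE -/(dyadic b k) /takagi.
  rewrite (cvg_lim _ (@cvg_series_takagi_dyadic R b k)) //.
  congr (_ * _); apply: eq_big_nat => i /andP[_ ik].
  by rewrite big_nat_recr ?(ltnW ik) //= bk /=; ring.
split=> //; rewrite digit_sum_formula; congr (_ * _).
apply: eq_big_nat => i /andP[_ ik].
by rewrite hb hamming_weight_div ?(ltnW ik) // natr_sum.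
Qed.
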